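(* On a cell $I_{ij}$, let reconstructed interface values $(\widehat B_1)_{i\pm\frac12,j}^{\mp,\mu}$ and $(\widehat B_2)_{i,j\pm\frac12}^{\mu,\mp}$, $1\le\mu\le Q$, be given real numbers, and define $$\nabla_h\cdot\widehat{\mathbf B}_{ij}=\sum_{\mu=1}^Q\omega_\mu\left(\frac{(\widehat B_1)_{i+\frac12,j}^{-,\mu}-(\widehat B_1)_{i-\frac12,j}^{+,\mu}}{\Delta x}+\frac{(\widehat B_2)_{i,j+\frac12}^{\mu,-}-(\widehat B_2)_{i,j-\frac12}^{\mu,+}}{\Delta y}\right),$$ $$A_1=\frac{\Delta x\,\nabla_h\cdot\widehat{\mathbf B}_{ij}}{2(1+(\Delta x/\Delta y)^2)},\qquad A_2=\frac{\Delta y\,\nabla_h\cdot\widehat{\mathbf B}_{ij}}{2(1+(\Delta y/\Delta x)^2)}.$$ Then the modified point values $$(\widetilde B_1)_{i\pm\frac12,j}^{\mp,\mu}=(\widehat B_1)_{i\pm\frac12,j}^{\mp,\mu}\mp A_1,\qquad(\widetilde B_2)_{i,j\pm\frac12}^{\mu,\mp}=(\widehat B_2)_{i,j\pm\frac12}^{\mu,\mp}\mp A_2,\qquad 1\le\mu\le Q,$$ satisfy the discrete divergence-free condition $$\nabla_h\cdot\widetilde{\mathbf B}_{ij}:=\sum_{\mu=1}^Q\omega_\mu\left(\frac{(\widetilde B_1)_{i+\frac12,j}^{-,\mu}-(\widetilde B_1)_{i-\frac12,j}^{+,\mu}}{\Delta x}+\frac{(\widetilde B_2)_{i,j+\frac12}^{\mu,-}-(\widetilde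 B_2)_{i,j-\frac12}^{\mu,+}}{\Delta y}\right)=0.$$
   Context: $I_{ij}$ is a cell of a uniform rectangular mesh with step sizes $\Delta x,\Delta y>0$. $\omega_1,\dots,\omega_Q$ are quadrature weights normalized so that $\sum_{\mu=1}^Q\omega_\mu=1$. $(\widehat B_1)_{i\pm\frac12,j}^{\mp,\mu}$ are point values of the first magnetic component at the $\mu$th quadrature node of the right ($+\frac12$, superscript $-$) and left ($-\frac12$, superscript $+$) edges of $I_{ij}$, taken from inside $I_{ij}$; $(\widehat B_2)_{i,j\pm\frac12}^{\mu,\mp}$ are those of the second component on the top and bottom edges. Upper signs go together and lower signs go together. *)

(* Defs.v *)
From mathcomp Require Import all_boot all_order all_algebra.
From mathcomp Require Import reals.

Set Implicit Arguments.
Unset Strict Implicit.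
Unset Printing Implicit Defensive.

Import Order.TTheory GRing.Theory Num.Theory.
Local Open Scope ring_scope.

(* The values of (B_1, B_2) at the [Q] quadrature nodes of the edges of one
   rectangular cell I_ij, taken from inside the cell. Only the first component
   is recorded on the vertical edges and only the second on the horizontal
   ones. The node index mu = 1, ..., Q is shifted to 0, ..., Q - 1. *)
Record edge_values (R : realType) (Q : nat) := EdgeValues {
  B1_right : 'I_Q -> R;  (* (B_1)_{i+1/2,j}^{-,mu} *)
  B1_left : 'I_Q -> R;   (* (B_1)_{i-1/2,j}^{+,mu} *)
  B2_top : 'I_Q -> R;    (* (B_2)_{i,j+1/2}^{mu,-} *)
  B2_bottom : 'I_Q -> R  (* (B_2)_{i,j-1/2}^{mu,+} *)
}.

Definition discrete_div (R : realType) (Q : nat) (w : 'I_Q -> R) (dx dy : R)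
    (B : edge_values R Q) : R :=
  \sum_(mu < Q) w mu * ((B1_right B mu - B1_left B mu) / dx
                        + (B2_top B mu - B2_bottom B mu) / dy).

Definition correction1 (R : realType) (Q : nat) (w : 'I_Q -> R) (dx dy : R)
    (B : edge_values R Q) : R :=
  (dx * discrete_div w dx dy B) / (2 * (1 + (dx / dy) ^+ 2)).

Definition correction2 (R : realType) (Q : nat) (w : 'I_Q -> R) (dx dy : R)
    (B : edge_values R Q) : R :=
  (dy * discrete_div w dx dy B) / (2 * (1 + (dy / dx) ^+ 2)).

Definition modified_values (R : realType) (Q : nat) (w : 'I_Q -> R) (dx dy : R)
    (B : edge_values R Q) : edge_values R Q :=
  EdgeValues (fun mu => B1_right B mu - correction1 w dx dy B)
             (fun mu => B1_left B mu + correction1 w dx dy B)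
             (fun mu => B2_top B mu - correction2 w dx dy B)
             (fun mu => B2_bottom B mu + correction2 w dx dy B).

(* Main.v *)
Require Import Defs.
From mathcomp Require Import all_boot all_order all_algebra.
From mathcomp Require Import reals.
From mathcomp Require Import ring.

Import Order.TTheory GRing.Theory Num.Theory.

Local Open Scope ring_scope.

(** The weights have total mass 1, so pushing opposite edges towards each
    other by constants [a1] and [a2] lowers the discrete divergence by exactly
    [2 * a1 / dx + 2 * a2 / dy] ([discrete_div_shift]). The two corrections
    split the divergence [D] in the proportions [dy ^ 2 : dx ^ 2], since
    [2 * A1 / dx = D * dy ^ 2 / (dx ^ 2 + dy ^ 2)] and
    [2 * A2 / dy = D * dx ^ 2 / (dx ^ 2 + dy ^ 2)]; together they remove all
    of it ([corrections_cancel_div]). *)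

(** The change in the integrand does not depend on the node, so it leaves the
    quadrature sum with the factor [\sum_mu w mu = 1]. *)
Lemma discrete_div_shift (R : realType) (Q : nat) (w : 'I_Q -> R)
    (dx dy a1 a2 : R) (B : edge_values R Q) :
  \sum_(mu < Q) w mu = 1 ->
  discrete_div w dx dy
    (EdgeValues (fun mu => B1_right B mu - a1) (fun mu => B1_left B mu + a1)
                (fun mu => B2_top B mu - a2) (fun mu => B2_bottom B mu + a2))
  = discrete_div w dx dy B - (2 * a1 / dx + 2 * a2 / dy).
Proof.
move=> hw; set c := 2 * a1 / dx + 2 * a2 / dy.
rewrite -[X in _ - X]mul1r -hw mulr_suml /discrete_div -sumrB /= {}/c.
by apply: eq_bigr => mu _; ring.
Qed.

Lemma corrections_cancel_div (R : realType) (Q : nat) (w : 'I_Q -> R)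
    (dx dy : R) (B : edge_values R Q) :
  0 < dx -> 0 < dy ->
  2 * correction1 w dx dy B / dx + 2 * correction2 w dx dy B / dy
  = discrete_div w dx dy B.
Proof.
move=> hdx hdy; rewrite /correction1 /correction2.
have sum_neq0 : dx ^+ 2 + dy ^+ 2 != 0 by rewrite gt_eqF ?addr_gt0 ?exprn_gt0.
field.
by rewrite sum_neq0 !gt_eqF.
Qed.

Theorem theorem2p6 (R : realType) (Q : nat) (w : 'I_Q -> R) (dx dy : R)
    (hdx : 0 < dx) (hdy : 0 < dy) (hw : \sum_(mu < Q) w mu = 1)
    (Bhat : edge_values R Q) :
  discrete_div w dx dy (modified_values w dx dy Bhat) = 0.
Proof.
by rewrite /modified_values discrete_div_shift // corrections_cancel_div // subrr.
Qed.
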